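(* Let $T$ be a tree with order $p$ and diameter $d \ge 2$, and let $\varepsilon = \varepsilon(T)$. Suppose there is a linear order $u_0, u_1, \ldots, u_{p-1}$ of the vertices of $T$ such that (a) $u_0 = w$ and $u_{p-1}$ is a neighbour of $w$ when $W(T) = \{w\}$, and $\{u_0,u_{p-1}\} = \{w,w'\}$ when $W(T) = \{w,w'\}$; (b) for each $0 \le i \le p-2$, $u_i$ and $u_{i+1}$ are in different branches if $W(T)=\{w\}$ and in opposite branches if $W(T) = \{w,w'\}$; and one of the following holds: (c) $\min\{d(u_i,u_{i+1}), d(u_{i+1},u_{i+2})\} \le (d+1-\varepsilon)/2$ for all $0 \le i \le p-3$; (d) $d(u_i,u_{i+1}) \le (d+1+\varepsilon)/2$ for all $0 \le i \le p-2$. Then $\mathrm{rn}(T) = (p-1)(d+\varepsilon) - 2L(T) + \varepsilon$, and the mapping $f$ with $f(u_0)=0$ and $f(u_{i+1}) = f(u_i) - L(u_{i+1}) - L(u_i) + (d+\varepsilon)$ ($0 \le i \le p-2$) is an optimal radio labeling of $T$.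
   Context: For a connected graph $G$, a radio labeling is a map $f: V(G) \to \{0,1,2,\ldots\}$ with $d(u,v) + |f(u)-f(v)| \ge \mathrm{diam}(G)+1$ for all distinct $u,v$; its span is $\max\{|f(u)-f(v)|\}$, and $\mathrm{rn}(G)$ is the minimum span over all radio labelings; a radio labeling is optimal if its span equals $\mathrm{rn}(G)$. For a tree $T$, let $w_T(v) = \sum_u d(u,v)$; weight centres are the minimizers of $w_T$, $W(T)$ is their set; a tree has one weight centre or two adjacent ones. $\varepsilon(T)=1$ if $|W(T)|=1$ and $0$ otherwise. Level $L(u) = \min\{d(u,x): x\in W(T)\}$, total level $L(T) = \sum_u L(u)$. Root $T$ at $W(T)$ and call descendants of $u$ the vertices $v \notin W(T)$ whose path from a weight centre passes through $u$. For a vertex $u \notin W(T)$ adjacent to a weight centre, the branch at $u$ is the subtree induced by $u$ and its descendants. Two branches are different if they are at two vertices adjacent to the same weight centre, and opposite if they are at vertices adjacent to different weight centres (possible only when $|W(T)|=2$). (A weight centre itself is regarded as lying in no branch, so it is in a different/opposite position to every branch in the sense of these conditions.)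
   Formalization: When W(T) = {w, w'}, a weight centre counts as opposite only to the other weight centre and its branches, not to its own branches; otherwise the claim fails, e.g. on the path a-w-w'-b with order w, a, b, w', whose labels 0, 2, 3, 5 violate the radio condition at (w, a). *)

(* Defs.v *)
From mathcomp Require Import all_boot all_order all_algebra.
From mathcomp Require Import boolp.

Set Implicit Arguments.
Unset Strict Implicit.
Unset Printing Implicit Defensive.

Section Graph.
Variables (T : finType) (e : rel T).

(* The default value #|T| is attained only when y is unreachable from x:
   shortest paths have length < #|T|. *)
Definition dist (x y : T) : nat :=
  \big[minn/#|T|]_(n < #|T| | [exists p : n.-tuple T,
                                 path e x p && (last x p == y)]) n.

Definition diam : nat := \max_(x : T) \max_(y : T) dist x y.

(* A duplicate-free closed walk x, y, x has size 2 and is not a cycle. *)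
Definition acyclic : Prop := forall c : seq T, ucycle e c -> size c <= 2.

Definition is_tree : Prop :=
  [/\ 0 < #|T|, symmetric e, irreflexive e,
      (forall x y, connect e x y) & acyclic].

Definition radio_labeling (f : T -> nat) : Prop :=
  forall u v, u != v -> diam + 1 <= dist u v + `|f u - f v|%N.

Definition span (f : T -> nat) : nat :=
  \max_(u : T) \max_(v : T) `|f u - f v|%N.

Lemma ex_radio_span :
  exists n, `[< exists f, radio_labeling f /\ span f = n >].
Proof.
pose f (v : T) := (diam + 1) * enum_rank v.
exists (span f); apply/asboolP; exists f; split=> // u v neq_uv.
have {neq_uv}: enum_rank u != enum_rank v :> nat.
  by apply: contra neq_uv => /eqP/val_inj/enum_rank_inj->.
rewrite /f; set a := nat_of_ord _; set b := nat_of_ord _ => neq_ab.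
apply: leq_trans (leq_addl _ _); rewrite !PoszM -GRing.mulrBr abszM.
by rewrite leq_pmulr // lt0n absz_eq0 GRing.subr_eq0.
Qed.

Definition rn : nat := ex_minn ex_radio_span.

Definition optimal_radio_labeling (f : T -> nat) : Prop :=
  radio_labeling f /\ span f = rn.

Definition weight (v : T) : nat := \sum_(u : T) dist u v.

Definition weight_centres : {set T} :=
  [set v | [forall u, weight v <= weight u]].

Definition eps : nat := #|weight_centres| == 1.

(* On a tree the minimum ranges over a nonempty set of values < #|T|. *)
Definition level (u : T) : nat :=
  \big[minn/#|T|]_(x in weight_centres) dist u x.

Definition total_level : nat := \sum_(u : T) level u.

Definition descendant (u v : T) : Prop :=
  v \notin weight_centres /\
  exists w p, [/\ w \in weight_centres, path e w p, uniq (w :: p),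
                  last w p = v & u \in w :: p].

Definition branch_root (w x : T) : Prop :=
  [/\ w \in weight_centres, x \notin weight_centres & e w x].

Definition in_branch (x v : T) : Prop := v = x \/ descendant x v.

(* A weight centre lies in no branch and counts as different from all of
   them. *)
Definition in_different_branches (u v : T) : Prop :=
  [\/ u \in weight_centres, v \in weight_centres |
      exists w x y, [/\ branch_root w x, branch_root w y, x <> y,
                        in_branch x u & in_branch y v]].

Definition on_side (w v : T) : Prop :=
  v = w \/ exists2 x, branch_root w x & in_branch x v.

(* A weight centre counts as opposite to the branches attached to the other
   weight centre.  It must not count as opposite to its own branches: on the
   path a - w - w' - b the order w, a, b, w' would then qualify, but the
   labels 0, 2, 3, 5 it receives violate the radio condition at (w, a). *)
Definition in_opposite_branches (u v : T) : Prop :=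
  exists w w', [/\ w \in weight_centres, w' \in weight_centres, w <> w',
                   on_side w u & on_side w' v].

(* Only the values u 0, ..., u (#|T| - 1) are meaningful. *)
Definition linear_order_of_vertices (u : nat -> T) : Prop :=
  (forall i j, i < #|T| -> j < #|T| -> u i = u j -> i = j) /\
  (forall x, exists2 i, i < #|T| & u i = x).

End Graph.

(* Main.v *)
Require Import Defs.
From mathcomp Require Import all_boot all_order all_algebra.
From mathcomp Require Import zify.

(** Simple paths in a tree are unique, so at a vertex [y] at most one neighbour
    is closer to a given [z] than [y] is.  Hence distances to [z], and strictly
    so the weights, are convex along paths: there are at most two weight
    centres, and two of them are adjacent.  Thus
    [d(x, y) <= L(x) + L(y) + 1 - eps] for all [x] and [y], with equality for
    vertices in different (opposite) branches.  Listing the vertices by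
    increasing label and telescoping the radio condition gives the lower bound.
    Conversely, the given order labels consecutive vertices with the exact gap
    [d + 1 - d(u_i, u_(i+1))].  The radio condition for larger index gaps
    follows from (d) at once.  Under (c), a vertex other than the ends lies on a
    short distance, so its level is at most [(d - 1 + eps) / 2], which settles
    index gap 3; gap 2 is the triangle inequality, and a gap of 4 or more
    contains two short distances. *)

Set Implicit Arguments.
Unset Strict Implicit.
Unset Printing Implicit Defensive.

(** * Minima of families of natural numbers *)

Lemma bigminn_le (I : eqType) (r : seq I) (P : pred I) (F : I -> nat) m i :
  i \in r -> P i -> \big[minn/m]_(j <- r | P j) F j <= F i.
Proof.
elim: r => // j r IHr; rewrite inE big_cons => /predU1P[<- Pi | ri Pi].
  by rewrite Pi geq_minl.
by case: ifP => _; rewrite ?geq_min IHr ?orbT.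
Qed.

Lemma bigminn_attained (I : Type) (r : seq I) (P : pred I) (F : I -> nat) m :
  let b := \big[minn/m]_(j <- r | P j) F j in
  b = m \/ exists2 i, P i & b = F i.
Proof.
apply: (big_ind (fun b => b = m \/ exists2 i, P i & b = F i)).
- by left.
- by move=> x y Kx Ky; case: (leqP x y) => _.
- by move=> i Pi; right; exists i.
Qed.

(** * Distance in a connected symmetric graph *)

Section Distance.
Variables (T : finType) (e : rel T).

Lemma uniq_size_card (s : seq T) : uniq s -> size s <= #|T|.
Proof. by move/card_uniqP <-; apply: max_card. Qed.

Lemma dist_last_le x p : path e x p -> dist e x (last x p) <= size p.
Proof.
(* Removing loops brings the length below [#|T|], into the index range of the minimum that defines
   [dist]. *)
move/shortenP=> [q xq uq sqp]; apply: leq_trans (uniq_leq_size _ sqp).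
  have ltq : size q < #|T| by apply: uniq_size_card uq.
  apply: (@bigminn_le _ _ _ (@nat_of_ord _) _ (Ordinal ltq)).
    by rewrite mem_index_enum.
  by apply/existsP; exists (in_tuple q); rewrite xq eqxx.
by case/andP: uq.
Qed.

Lemma distxx x : dist e x x = 0.
Proof. by apply/eqP; rewrite -leqn0 (@dist_last_le x [::]). Qed.

Lemma dist_edge_le x y : e x y -> dist e x y <= 1.
Proof. by move=> exy; apply: (@dist_last_le x [:: y]); rewrite /= exy. Qed.

Lemma dist_le_diam x y : dist e x y <= diam e.
Proof.
apply: leq_trans (leq_bigmax_cond (F := fun x => \max_y dist e x y) x isT).
exact: (leq_bigmax_cond (F := fun y => dist e x y)).
Qed.

Hypothesis conn : forall x y, connect e x y.

Lemma dist_uniq_path x y :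
  exists p, [/\ path e x p, uniq (x :: p), last x p = y & size p = dist e x y].
Proof.
(* Any duplicate-free path excludes the default value [#|T|]. *)
have ltd : dist e x y < #|T|.
  case/connectP: (conn x y) => p /shortenP[q xq uq _] ->.
  apply: leq_ltn_trans (dist_last_le xq) _.
  exact: uniq_size_card uq.
have := @bigminn_attained _ (index_enum 'I_#|T|)
  (fun n => [exists p : n.-tuple T, path e x p && (last x p == y)])
  (@nat_of_ord _) #|T|.
rewrite /= -/(dist e x y) => -[dT | [n /existsP[p /andP[xp /eqP yp]] dn]].
  by rewrite dT ltnn in ltd.
have szp : size p = dist e x y by rewrite size_tuple dn.
case/shortenP: xp yp => q xq uq sqp yq.
exists q; split=> //; apply/eqP; rewrite eqn_leq -{2}yq dist_last_le // -szp.
by rewrite uniq_leq_size //; case/andP: uq.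
Qed.

Lemma dist_eq0 x y : (dist e x y == 0) = (x == y).
Proof.
apply/idP/eqP => [/eqP d0 | ->]; last by rewrite distxx.
by have [[|? ?] [_ _ //=]] := dist_uniq_path x y; rewrite d0.
Qed.

Lemma dist_triangle y x z : dist e x z <= dist e x y + dist e y z.
Proof.
have [p [xp _ yp <-]] := dist_uniq_path x y.
have [q [yq _ <- <-]] := dist_uniq_path y z.
by rewrite -size_cat -yp -last_cat dist_last_le // cat_path xp yp.
Qed.

Hypothesis esym : symmetric e.

Lemma distC x y : dist e x y = dist e y x.
Proof.
suff le x' y' : dist e x' y' <= dist e y' x' by apply/eqP; rewrite eqn_leq !le.
have [p [yp _ xp <-]] := dist_uniq_path y' x'.
have := @dist_last_le (last y' p) (rev (belast y' p)).
rewrite rev_path (@eq_path _ _ e) => [/(_ yp)|a b]; last by rewrite esym.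
rewrite xp size_rev size_belast; case: p {yp} xp => [|a p] /=.
  by move=> <-; rewrite distxx.
by move=> _; rewrite rev_cons last_rcons.
Qed.

End Distance.

(** * Unique paths and convexity of distance in a tree *)

Section Tree.
Variables (T : finType) (e : rel T).
Hypothesis treeT : is_tree e.

Let esym : symmetric e. Proof. by case: treeT. Qed.
Let eirr : irreflexive e. Proof. by case: treeT. Qed.
Let conn : forall x y, connect e x y. Proof. by case: treeT. Qed.
Let acyc : acyclic e. Proof. by case: treeT. Qed.

Local Notation d := (dist e).
Local Notation W := (weight_centres e).
Local Notation L := (level e).

(** Where the two paths first diverge, at [x], their tails connect two neighbours [a] and [b] of [x]
    without using [x]; this closes a cycle through [x]. *)
Lemma uniq_path_unique x p q :
  path e x p -> path e x q -> uniq (x :: p) -> uniq (x :: q) ->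
  last x p = last x q -> p = q.
Proof.
elim: p x q => [|a p IHp] x [|b q] //=.
- by move=> _ _ _ /andP[xq _] xE; rewrite {1}xE mem_last in xq.
- by move=> _ _ /andP[xq _] _ xE; rewrite -{1}xE mem_last in xq.
move=> /andP[xa ap] /andP[xb bq] /andP[xp up] /andP[xq uq] lpq.
have [ab | nab] := eqVneq a b.
  by rewrite -ab in bq uq lpq *; rewrite (IHp a q).
(* [e'] is the graph with [x] deleted; both tails survive in it and meet at their common last
   vertex. *)
pose e' := [rel y z | [&& e y z, x != y & x != z]].
have e'sym : connect_sym e'.
  by apply: sym_connect_sym => y z /=; rewrite esym [X in _ && X]andbC.
have avoid y r : path e y r -> x \notin y :: r -> connect e' y (last y r).
  move=> yr xr; apply/connectP; exists r => //.
  elim: r y yr xr => //= z r IHr y /andP[yz zr].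
  rewrite !inE => /norP[xy /norP[xz xr]].
  by rewrite yz xy xz IHr // inE negb_or xz.
have : connect e' a b.
  by rewrite (connect_trans (avoid _ _ ap xp)) // lpq e'sym avoid.
case/connectP=> r0 /shortenP[r ar ur _] bE.
have xr : x \notin a :: r.
  move: xp; rewrite !inE !negb_or => /andP[-> _] /=.
  elim: (r) (a) ar => //= z s IHs y /andP[/and3P[_ _ xz] zs].
  by rewrite inE negb_or xz (IHs z).
have : size [:: x, a & r] <= 2.
  apply: acyc; rewrite /ucycle /= xa xr -andbA.
  rewrite rcons_path -bE [e b x]esym xb (sub_path _ ar) //= => ? ? /=.
  by case/andP.
by case: (r) bE => //= bE; rewrite bE eqxx in nab.
Qed.

Lemma dist_simple_path x p :
  path e x p -> uniq (x :: p) -> d x (last x p) = size p.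
Proof.
move=> xp up; have [q [xq uq yq <-]] := dist_uniq_path conn x (last x p).
by rewrite (uniq_path_unique xq xp uq up yq).
Qed.

Lemma dist_edge x y : e x y -> d x y = 1.
Proof.
move=> xy; apply: (@dist_simple_path x [:: y]); rewrite /= ?xy ?inE //.
by rewrite andbT; apply: contraTneq xy => ->; rewrite eirr.
Qed.

(* At most one neighbour of [y] is closer to [z] than [y] is: the first vertex
   of the path from [y] to [z]. *)
Lemma dist_convex z x y x' :
  e y x -> e y x' -> x != x' -> 2 * d z y <= d z x + d z x'.
Proof.
move=> yx yx' nxx'; rewrite !(distC conn esym z).
have [p [yp up zp szp]] := dist_uniq_path conn y z.
(* Prefixing [v] to the path from [y] to [z] keeps it simple: if [v] lay on that path, uniqueness
   would make it the first vertex after [y]. *)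
have far v : e y v -> v != head y p -> d v z = (d y z).+1.
  move=> yv nv; rewrite -szp -zp.
  apply: (@dist_simple_path v (y :: p)); first by rewrite /= esym yv.
  rewrite cons_uniq up andbT; apply/negP; rewrite inE => /predU1P[vy | vp].
    by rewrite vy eirr in yv.
  case/splitPr: vp yp up nv {zp szp} => p1 p2.
  rewrite -cat_rcons cat_path -cat_cons cat_uniq => /andP[yp1 _] /andP[up1 _].
  suff /= -> : rcons p1 v = [:: v] by rewrite eqxx.
  apply: (uniq_path_unique yp1 _ up1); rewrite ?last_rcons //= ?yv //.
  rewrite inE andbT; apply: contraTneq yv => ->; by rewrite eirr.
have near v : e y v -> d y z <= (d v z).+1.
  by move=> yv; rewrite -add1n -(dist_edge yv) dist_triangle.
have [xE | xN] := eqVneq x (head y p).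
  by have := far _ yx'; rewrite -xE eq_sym => /(_ nxx'); have := near _ yx; lia.
by have := far _ yx xN; have := near _ yx'; lia.
Qed.

(** By convexity, a simple path whose first step leads away from [z] never turns back, so each step
    adds exactly one. *)
Lemma dist_escape z x y q :
  path e x (y :: q) -> uniq [:: x, y & q] -> d z x < d z y ->
  d z (last y q) = d z x + (size q).+1.
Proof.
elim: q x y => [|y' q IHq] x y.
  rewrite /= andbT => xy _ lt; have := dist_triangle conn x z y.
  by rewrite (dist_edge xy); lia.
move=> /= /and3P[xy yy' y'q] /and3P[xN yN uq] lt.
rewrite [last _ _]/= (IHq y) /= ?yy' ?y'q ?yN //.
  by have := dist_triangle conn x z y; rewrite (dist_edge xy); lia.
have nxy' : x != y' by apply: contraNneq xN => ->; rewrite !inE eqxx orbT.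
by have := dist_convex z _ yy' nxy'; rewrite esym xy => /(_ isT); lia.
Qed.

(** The shortest path from [b] to [y] avoids [a], since [y] is closer to [b]. Preceded by [a], it
    starts by moving away from [x], so [dist_escape] measures it. *)
Lemma dist_across_edge x y a b :
  e a b -> d x a < d x b -> d y b < d y a -> d x y = d x a + 1 + d y b.
Proof.
move=> ab xab; rewrite !(distC conn esym y).
have [q [bq uq <- <-]] := dist_uniq_path conn b y => yba.
rewrite (@dist_escape x a b q) /= ?ab //; first lia.
rewrite -cons_uniq cons_uniq uq andbT; apply: contraL yba => aq.
case/splitPl: aq bq {uq} => q1 q2 aE; rewrite cat_path last_cat aE size_cat.
by case/andP=> _ /dist_last_le; lia.
Qed.

(** * Weights and weight centres *)

Lemma weight_convex x y x' :
  e y x -> e y x' -> x != x' -> 2 * weight e y < weight e x + weight e x'.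
Proof.
move=> yx yx' nxx'; rewrite /weight big_distrr -big_split /=.
(* The summand of [y] itself is 0 on the left and 2 on the right, which makes the inequality
   strict. *)
rewrite (bigD1 y) // [X in _ < X](bigD1 y) //= distxx (dist_edge yx).
rewrite (dist_edge yx') ltnS muln0 leqW // leq_sum // => z _.
exact: dist_convex.
Qed.

(** After a first step that does not lower the weight, strict convexity makes all later steps raise
    it. The first step may be level, hence the demand for a second one. *)
Lemma weight_path_increasing x y q :
  path e x (y :: q) -> uniq [:: x, y & q] -> weight e x <= weight e y ->
  0 < size q -> weight e x < weight e (last y q).
Proof.
elim: q x y => // y' q IHq x y /= /and3P[xy yy' y'q] /and3P[xN yN uq] le _.
have nxy' : x != y' by apply: contraNneq xN => ->; rewrite !inE eqxx orbT.
have lt : weight e y < weight e y'.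
  by have := weight_convex _ yy' nxy'; rewrite esym xy => /(_ isT); lia.
case: q IHq y'q yN uq {xN} => [|y'' q] IHq y'q yN uq /=; first lia.
apply: leq_ltn_trans le (IHq y y' _ _ (ltnW lt) isT); first by rewrite /= yy'.
by rewrite cons_uniq yN.
Qed.

Lemma weight_centreP w x : w \in W -> weight e w <= weight e x.
Proof. by rewrite inE => /forallP. Qed.

Lemma weight_centres_adjacent w w' : w \in W -> w' \in W -> w != w' -> e w w'.
Proof.
move=> Ww Ww' nww'.
have [[|y [|y' q]] [wq uq lq _]] := dist_uniq_path conn w w'.
- by rewrite -lq eqxx in nww'.
- by move: wq lq; rewrite /= andbT => wy <-.
have := weight_path_increasing wq uq (weight_centreP y Ww) isT.
by rewrite -[last y _]/(last w [:: y, y' & q]) lq ltnNge weight_centreP.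
Qed.

Lemma weight_centres_cases :
  (exists2 w, W = [set w] & eps e = 1) \/
  (exists w w', [/\ w <> w', W = [set w; w'], e w w' & eps e = 0]).
Proof.
have [x0 _] : exists x0 : T, x0 \in T.
  by apply/card_gt0P; case: treeT.
have [w _ wmin] := arg_minnP (P := predT) (weight e) (isT : predT x0).
have Ww : w \in W by rewrite inE; apply/forallP => x; apply: wmin.
case: (pickP [pred w' in W | w' != w]) => [w' /andP[Ww' nw'w] | W1]; last first.
  have WE : W = [set w].
    apply/setP=> x; have := W1 x; rewrite in_set1 /=.
    by case: eqVneq => [-> | _]; rewrite ?Ww ?andbT.
  by left; exists w; rewrite // /eps WE cards1.
have ww' : e w w' by apply: weight_centres_adjacent => //; rewrite eq_sym.
have WE : W = [set w; w'].
  apply/setP=> x; rewrite in_set2.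
  have [-> | nxw] := eqVneq x w; first by rewrite Ww.
  have [-> | nxw'] := eqVneq x w'; first by rewrite Ww'.
  (* Centres are pairwise adjacent, so a third one would form a triangle. *)
  apply/negP=> Wx; suff: size [:: w; w'; x] <= 2 by [].
  apply: acyc; rewrite /ucycle /= ww' !inE negb_or.
  rewrite [w == w']eq_sym [w == x]eq_sym [w' == x]eq_sym nw'w nxw nxw'.
  rewrite [w' == w]eq_sym in nw'w.
  by rewrite !weight_centres_adjacent // eq_sym.
right; exists w, w'; split=> //; first by apply/eqP; rewrite eq_sym.
by rewrite /eps WE cards2 [w == w']eq_sym nw'w.
Qed.

(** * Levels and distances between arbitrary vertices *)

Lemma level_le w x : w \in W -> L x <= d x w.
Proof. by move=> Ww; apply: bigminn_le => //; rewrite mem_index_enum. Qed.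

Lemma level_attained x : exists2 w, w \in W & L x = d x w.
Proof.
have [w Ww] : exists w, w \in W.
  case: weight_centres_cases => [[w -> _] | [w [w' [_ -> _ _]]]];
    by exists w; rewrite !inE eqxx.
have [LT | //] := @bigminn_attained _ (index_enum T) (mem W) (d x) #|T|.
have [p [_ up _ szp]] := dist_uniq_path conn x w.
have := level_le x Ww; rewrite /level LT -szp.
by move/leq_ltn_trans/(_ (uniq_size_card up)); rewrite ltnn.
Qed.

Lemma level_centre w : w \in W -> L w = 0.
Proof. by move/(level_le w); rewrite distxx leqn0 => /eqP. Qed.

Lemma level_eq0 x : L x = 0 -> x \in W.
Proof.
by have [w Ww ->] := level_attained x => /eqP; rewrite dist_eq0 // => /eqP->.
Qed.

Lemma dist_centres w w' : w \in W -> w' \in W -> d w w' <= 1 - eps e.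
Proof.
case: weight_centres_cases => [[w1 -> ->] | [w1 [w2 [_ WE _ ->]]] Ww Ww'].
  by rewrite !inE => /eqP-> /eqP->; rewrite distxx.
have [-> | nww'] := eqVneq w w'; first by rewrite distxx.
exact: dist_edge_le (weight_centres_adjacent Ww Ww' nww').
Qed.

Lemma dist_le_levels x y : d x y <= L x + L y + (1 - eps e).
Proof.
have [w Ww ->] := level_attained x; have [w' Ww' ->] := level_attained y.
have := dist_centres Ww Ww'; have := dist_triangle conn w x y.
by have := dist_triangle conn w' w y; rewrite (distC conn esym y); lia.
Qed.

(** * Distances between vertices of different or opposite branches *)

Lemma in_branch_closer w x v :
  branch_root e w x -> in_branch e x v -> d v x < d v w.
Proof.
case=> Ww Wx wx [-> | [_ [w0 [q [Ww0 wq uq <- xq]]]]].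
  by rewrite distxx distC // dist_edge.
(* The descending path may start at the other centre [w0]; convexity at [w] then puts [w] between
   [w0] and [x]. *)
have w0x : d w0 x = d w0 w + 1.
  have [-> | nw] := eqVneq w0 w; first by rewrite distxx dist_edge.
  have ww0 : e w w0 by apply: weight_centres_adjacent => //; rewrite eq_sym.
  have nw0x : w0 != x by apply: contraNneq Wx => <-.
  have := dist_convex w0 ww0 wx nw0x; rewrite distxx.
  have := dist_triangle conn w w0 x; rewrite (dist_edge wx).
  by rewrite (distC conn esym w0 w) (dist_edge ww0); lia.
(* The simple path from [w0] to [v] is shortest and passes through [x]; it is compared with the
   route through [w]. *)
case/splitPl: xq wq uq => q1 q2 xE wq uq.
have := dist_simple_path wq uq; move: wq uq.
rewrite cat_path last_cat -cat_cons cat_uniq xE => /andP[wq1 xq2] /andP[uq1 _].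
have := dist_simple_path wq1 uq1; rewrite xE size_cat w0x => <-.
have := dist_last_le xq2; have := dist_triangle conn w w0 (last x q2).
by rewrite !(distC conn esym (last x q2)); lia.
Qed.

(** Stepping from [w] into the branch of [v] brings it closer, so by convexity at [w] the step to
    [w'] leads away. *)
Lemma on_side_closer w w' v :
  w' \in W -> w' <> w -> on_side e w v -> w \in W -> d v w < d v w'.
Proof.
move=> Ww' /eqP nw'w sv Ww.
have ww' : e w w' by apply: weight_centres_adjacent => //; rewrite eq_sym.
case: sv => [-> | [x rx bx]]; first by rewrite distxx dist_edge.
have := in_branch_closer rx bx; case: rx => _ Wx wx.
have nxw' : x != w' by apply: contraNneq Wx => ->.
by have := dist_convex v wx ww' nxw'; lia.
Qed.

Lemma dist_different_branches w x y :
  W = [set w] -> in_different_branches e x y -> d x y = L x + L y.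
Proof.
move=> WE.
have LE v : L v = d v w.
  by have [w' + ->] := level_attained v; rewrite WE inE => /eqP->.
rewrite !{}LE; case.
- by rewrite WE inE => /eqP->; rewrite distxx distC.
- by rewrite WE inE => /eqP->; rewrite distxx addn0.
case=> w' [a [b [ra rb nab xa yb]]].
have := in_branch_closer ra xa; have := in_branch_closer rb yb.
have w'E : w' = w by case: ra => + _ _; rewrite WE inE => /eqP.
case: ra rb => _ _; rewrite w'E => wa [_ _ wb] yb_lt xa_lt.
(* The edge from [w] to the root [b] of the branch of [y] separates [x] from [y]. *)
have xb_lt : d x w < d x b.
  by have := dist_convex x wa wb (introN eqP nab); lia.
rewrite (dist_across_edge wb xb_lt yb_lt); have := dist_triangle conn b y w.
by rewrite (distC conn esym b) (dist_edge wb); lia.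
Qed.

(** The edge joining the two centres separates [x] from [y] and accounts for the extra 1. *)
Lemma dist_opposite_branches w w' x y :
  W = [set w; w'] -> in_opposite_branches e x y -> d x y = L x + L y + 1.
Proof.
move=> WE [a [b [Wa Wb nab xa yb]]].
have xab := on_side_closer Wb (nesym nab) xa Wa.
have yba := on_side_closer Wa nab yb Wb.
have eab : e a b by apply: weight_centres_adjacent => //; apply/eqP.
rewrite (dist_across_edge eab xab yba).
have WE' v : v \in W -> v = a \/ v = b.
  move: Wa Wb; rewrite WE !inE.
  do 3![case/pred2P=> ?]; subst; by [left | right | case: nab].
have -> : L x = d x a.
  have := level_le x Wa; have [v + ->] := level_attained x.
  by case/WE'=> ->; lia.
have -> : L y = d y b.
  have := level_le y Wb; have [v + ->] := level_attained y.
  by case/WE'=> ->; lia.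
lia.
Qed.

End Tree.

(** * Sums along a linear order, and sorting by label *)

Lemma sum_linear_order (T : finType) (u : nat -> T) (F : T -> nat) :
  linear_order_of_vertices u -> \sum_(i < #|T|) F (u i) = \sum_x F x.
Proof.
case=> uI _; rewrite (reindex (fun i : 'I_#|T| => u i)) //.
apply: onW_bij; apply: inj_card_bij; last by rewrite card_ord.
by move=> i j /uI eq_ij; apply/val_inj/eq_ij.
Qed.

(** Inner terms occur in two consecutive pairs, the two end terms in only one. *)
Lemma sum_consecutive (F : nat -> nat) n :
  \sum_(i < n) (F i + F i.+1) + (F 0 + F n) = 2 * \sum_(i < n.+1) F i.
Proof.
elim: n => [|n IHn]; first by rewrite big_ord0 big_ord1 /=; lia.
by rewrite big_ord_recr [in RHS]big_ord_recr /=; move: IHn => /=; lia.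
Qed.

Lemma telescope_ge (a b : nat -> nat) c n :
  (forall i, i < n -> a i + c <= a i.+1 + b i) ->
  a 0 + n * c <= a n + \sum_(i < n) b i.
Proof.
elim: n => [|n IHn] step; first by rewrite big_ord0.
have := IHn (fun i lt_in => step i (ltnW lt_in)); have := step n (leqnn _).
by rewrite [in X in _ -> _ -> X]big_ord_recr /=; lia.
Qed.

Lemma linear_order_sorting (T : finType) (g : T -> nat) :
  0 < #|T| -> exists u : nat -> T, linear_order_of_vertices u /\
    forall i j, i <= j -> j < #|T| -> g (u i) <= g (u j).
Proof.
case/card_gt0P=> x0 _; pose s := sort (relpre g leq) (enum T).
have szs : size s = #|T| by rewrite size_sort cardE.
exists (nth x0 s); split; first split.
- move=> i j ip jp /eqP; rewrite nth_uniq ?szs ?sort_uniq ?enum_uniq //.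
  by move/eqP.
- move=> x; exists (index x s); last by rewrite nth_index // mem_sort mem_enum.
  by rewrite -szs index_mem mem_sort mem_enum.
move=> i j le_ij jp.
have tot : total (relpre g leq) by move=> x y; apply: leq_total.
apply: (sorted_leq_nth _ _ x0 (sort_sorted tot _)) => //.
- by move=> x y z; apply: leq_trans.
- by move=> x; apply: leqnn.
- by rewrite inE szs (leq_ltn_trans le_ij).
- by rewrite inE szs.
Qed.

(** * The lower bound on the span, and the radio condition from consecutive gaps *)

Section Labelings.
Variables (T : finType) (e : rel T).
Hypothesis treeT : is_tree e.

Let esym : symmetric e. Proof. by case: treeT. Qed.
Let conn : forall x y, connect e x y. Proof. by case: treeT. Qed.

Local Notation d := (dist e).
Local Notation L := (level e).

Lemma eps_le1 : eps e <= 1.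
Proof. exact: leq_b1. Qed.

Lemma span_ge (g : T -> nat) x y : g x <= Defs.span g + g y.
Proof.
have := leq_bigmax_cond (F := fun x : T => \max_(y : T) `|g x - g y|%N) x isT.
have := leq_bigmax_cond (F := fun y : T => `|g x - g y|%N) y isT.
by rewrite /Defs.span /=; lia.
Qed.

(** A unique centre is the only vertex of level 0. Applied to the first and last vertices, this
    yields the final [eps e] of the lower bound. *)
Lemma level_eps x y : x <> y -> eps e <= L x + L y.
Proof.
move=> nxy.
case: (weight_centres_cases treeT) => [[w WE ->] | [? [? [_ _ _ ->]]]] //.
rewrite lt0n addn_eq0; apply/negP=> /andP[/eqP Lx /eqP Ly]; case: nxy.
move: (level_eq0 treeT Lx) (level_eq0 treeT Ly).
by rewrite WE !inE => /eqP-> /eqP.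
Qed.

Lemma radio_span_ge (g : T -> nat) :
  1 < #|T| -> radio_labeling e g ->
  #|T|.-1 * (diam e + eps e) + eps e <= Defs.span g + 2 * total_level e.
Proof.
move=> T1 radg; have [u [ou gu]] := linear_order_sorting g (ltnW T1).
rewrite /total_level -(sum_linear_order _ ou).
have [uI _] := ou; case: #|T| T1 gu uI => // n n0 gu uI /=.
rewrite -(sum_consecutive (fun i => L (u i))) /=.
have Leps : eps e <= L (u 0) + L (u n).
  by apply: level_eps => /uI => /(_ isT (leqnn _)); lia.
(* The pair sums miss one copy of each end level from twice the total level; [Leps] bounds what is
   missing. *)
suff : g (u 0) + n * (diam e + eps e) <=
       g (u n) + \sum_(i < n) (L (u i) + L (u i.+1)).
  by have := span_ge g (u n) (u 0) => /=; lia.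
apply: (@telescope_ge (g \o u) (fun i => L (u i) + L (u i.+1))) => i ltin /=.
have := gu i i.+1 (leqnSn _) ltin.
have neq : u i != u i.+1.
  by apply/eqP=> /uI => /(_ (ltnW ltin) ltin); lia.
have := radg _ _ neq; have := dist_le_levels treeT (u i) (u i.+1).
by have := eps_le1; lia.
Qed.

Lemma consecutive_gaps_suffice n (u : nat -> T) (F : nat -> nat) :
  2 <= diam e -> (forall i j, i < j <= n -> u i != u j) ->
  L (u 0) <= eps e -> L (u n) <= eps e ->
  (forall i, i < n -> d (u i) (u i.+1) = L (u i) + L (u i.+1) + (1 - eps e)) ->
  (forall i, i < n -> F i.+1 + d (u i) (u i.+1) = F i + (diam e + 1)) ->
  (forall i, i.+1 < n ->
     2 * minn (d (u i) (u i.+1)) (d (u i.+1) (u i.+2)) <= diam e + 1 - eps e) \/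
  (forall i, i < n -> 2 * d (u i) (u i.+1) <= diam e + 1 + eps e) ->
  forall i j, i < j <= n -> diam e + 1 + F i <= d (u i) (u j) + F j.
Proof.
move=> d2 u_neq Lu0 Lun dL dF cd; have eps1 := eps_le1.
have dd i : d (u i) (u i.+1) <= diam e by apply: dist_le_diam.
have Fmono k m : k + m <= n -> F k + m <= F (k + m).
  elim: m => [|m IHm]; first by rewrite !addn0.
  rewrite addnS => lt; have := IHm (ltnW lt); have := dF _ lt.
  by have := dd (k + m); lia.
have Fle k m : k <= m -> m <= n -> F k <= F m.
  by move=> le_km le_mn; have := @Fmono k (m - k); rewrite subnKC //; lia.
have dpos i j : i < j <= n -> 0 < d (u i) (u j).
  by move=> /u_neq; rewrite lt0n dist_eq0.
move=> i j /andP[ltij lejn]; have [jE | ltij1] := leqP j i.+1.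
  have -> : j = i.+1 by lia.
  by have := dF i; lia.
have := dpos i j; rewrite ltij lejn => /(_ isT) dij.
(* Under (d), two consecutive gaps sum to at least [diam e + 1 - eps e], and [dij] makes up for
   [eps e]. *)
case: cd => [c | dd']; last first.
  have := Fle i.+2 j ltij1 lejn; have := dF i; have := dF i.+1.
  by have := dd' i; have := dd' i.+1; lia.
(* An inner vertex lies on a short distance, which bounds its level; at the ends the level is at
   most [eps e] and [2 <= diam e] suffices. *)
have Lmid k : k <= n -> 2 * L (u k) + 1 <= diam e + eps e.
  case: k => [|k] lekn; first lia.
  have [kn | ltkn] := eqVneq k.+1 n; first by rewrite kn; lia.
  by have := c k; have := dL k; have := dL k.+1; lia.
have ci := c i; have dFi := dF i; have dFi1 := dF i.+1.
(* With consecutive distances [a] and [b], the two gaps sum to [2 * (diam e + 1) - a - b], and the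
   outer vertices are at least [|a - b|] apart. The total is [2 * (diam e + 1)] minus twice the
   smaller distance. *)
have [jE | ltij2] := leqP j i.+2.
  have jE2 : j = i.+2 by lia.
  rewrite jE2 in lejn *.
  have := dist_triangle conn (u i.+2) (u i) (u i.+1).
  have := dist_triangle conn (u i) (u i.+1) (u i.+2).
  rewrite (distC conn esym (u i.+2) (u i.+1)) (distC conn esym (u i.+1) (u i)).
  by have := dd i; have := dd i.+1; lia.
have ci1 := c i.+1; have dFi2 := dF i.+2.
(* Either both outer distances are short, or the middle one is. In the latter case [dL] makes the
   outer two sum to the middle one plus the levels of [u i] and [u j] plus [1 - eps e], and [Lmid]
   bounds these levels. *)
have [jE | ltij3] := leqP j i.+3.
  have jE3 : j = i.+3 by lia.
  rewrite jE3 in lejn dij *.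
  have := dL i; have := dL i.+1; have := dL i.+2; have := Lmid i.
  have := Lmid i.+3; have := dd i; have := dd i.+1; have := dd i.+2; lia.
(* Each of the two short distances gives a gap of at least half of [diam e + 1]. *)
have := Fle i.+4 j ltij3 lejn; have := c i.+2; have := dF i.+3.
have := dd i; have := dd i.+1; have := dd i.+2; have := dd i.+3; lia.
Qed.

End Labelings.

(** * The labeling built from the given order and its optimality *)

Theorem theorem3p6 (T : finType) (e : rel T) (p d : nat) (u : nat -> T)
  (treeT : is_tree e) (order_p : #|T| = p) (diam_d : diam e = d)
  (d_ge2 : 2 <= d)
  (u_order : linear_order_of_vertices u)
  (cond_a :
     (forall w, weight_centres e = [set w] -> u 0 = w /\ e w (u p.-1)) /\
     (forall w w', w <> w' -> weight_centres e = [set w; w'] ->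
        [set u 0; u p.-1] = [set w; w']))
  (cond_b : forall i, i.+1 < p ->
     (forall w, weight_centres e = [set w] ->
        in_different_branches e (u i) (u i.+1)) /\
     (forall w w', w <> w' -> weight_centres e = [set w; w'] ->
        in_opposite_branches e (u i) (u i.+1)))
  (cond_c_or_d :
     (forall i, i.+2 < p ->
        2 * minn (dist e (u i) (u i.+1)) (dist e (u i.+1) (u i.+2))
          <= d + 1 - eps e) \/
     (forall i, i.+1 < p ->
        2 * dist e (u i) (u i.+1) <= d + 1 + eps e)) :
  ((rn e)%:Z = (p%:Z - 1) * (d%:Z + (eps e)%:Z)
               - 2 * (total_level e)%:Z + (eps e)%:Z)%R /\
  exists f : T -> nat,
    [/\ f (u 0) = 0,
        (forall i, i.+1 < p ->
           ((f (u i.+1))%:Z = (f (u i))%:Z - (level e (u i.+1))%:Z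
              - (level e (u i))%:Z + (d%:Z + (eps e)%:Z))%R)
      & optimal_radio_labeling e f].
Proof.
have [_ esym _ conn _] := treeT; have eps1 := eps_le1 e.
have [uI uS] := u_order.
case: p order_p cond_a cond_b cond_c_or_d => [|n] order_p cond_a cond_b cond_cd.
  by case: treeT; rewrite order_p.
have n0 : 0 < n.
  rewrite lt0n; apply/eqP=> nE; move: d_ge2; rewrite -diam_d leqNgt ltnS.
  case/negP; apply/bigmax_leqP=> x _; apply/bigmax_leqP=> y _.
  have [i + <-] := uS x; have [j + <-] := uS y; rewrite order_p nE.
  by case: i j => [] // [] // _ _; rewrite distxx.
rewrite order_p /= in uI uS cond_a.
have ends : level e (u 0) = 0 /\ level e (u n) = eps e.
  case: (weight_centres_cases treeT) => [[w WE epsE] | [w [w' [nw WE _ epsE]]]].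
    have [u0 wun] := cond_a.1 w WE.
    have Ww : w \in weight_centres e by rewrite WE inE.
    split; first by rewrite u0 level_centre.
    have [w' + ->] := level_attained treeT (u n); rewrite WE inE => /eqP->.
    by rewrite epsE distC // dist_edge.
  have := cond_a.2 w w' nw WE; rewrite -WE => WE'.
  by rewrite epsE !level_centre // -WE' !inE eqxx ?orbT.
case: ends => Lu0 Lun.
have dL i : i < n ->
  dist e (u i) (u i.+1) = level e (u i) + level e (u i.+1) + (1 - eps e).
  move=> ltin; have [bd bo] := cond_b i ltin.
  case: (weight_centres_cases treeT) => [[w WE epsE] | [w [w' [nw WE _ epsE]]]].
    by rewrite (dist_different_branches treeT WE (bd w WE)) epsE; lia.
  by rewrite (dist_opposite_branches treeT WE (bo w w' nw WE)) epsE; lia.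
have dd i : dist e (u i) (u i.+1) <= d by rewrite -diam_d dist_le_diam.
(* [F] gives the labels by position, with the smallest gaps allowed between neighbours in the order;
   [dd] keeps the truncated subtraction exact. *)
pose F m := \sum_(j < m) (d + 1 - dist e (u j) (u j.+1)).
have dF i : F i.+1 + dist e (u i) (u i.+1) = F i + (d + 1).
  by rewrite /F big_ord_recr /=; have := dd i; lia.
have gap i j : i < j <= n -> d + 1 + F i <= dist e (u i) (u j) + F j.
  rewrite -diam_d; apply: consecutive_gaps_suffice;
    rewrite ?diam_d ?Lu0 ?Lun //.
  move=> i' j' /andP[lt le]; apply/eqP=> /uI eq.
  by have := eq (leq_trans lt (leqW le)) le; lia.
have Fmono i j : i <= j -> F i <= F j.
  move=> le_ij; rewrite -(subnKC le_ij); elim: (j - i) => [|k IHk].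
    by rewrite addn0.
  by rewrite addnS; have := dF (i + k); have := dd (i + k); lia.
(* By [dL] each gap is [d + eps e] minus two levels; the ends contribute levels 0 and [eps e], so
   the last label equals the lower bound. *)
have FE : F n + 2 * total_level e = n * (d + eps e) + eps e.
  have sumF m : m <= n ->
    F m + \sum_(i < m) (level e (u i) + level e (u i.+1)) = m * (d + eps e).
    elim: m => [|m IHm] lt; first by rewrite /F !big_ord0.
    rewrite big_ord_recr /=; have /= := IHm (ltnW lt).
    by have := dF m; have := dL m lt; lia.
  rewrite /total_level -(sum_linear_order _ u_order) order_p.
  rewrite -(sum_consecutive (fun i => level e (u i))) Lu0 Lun.
  by have /= := sumF n (leqnn n); lia.
pose f x := F (index x (mkseq u n.+1)).
have us : uniq (mkseq u n.+1).
  by apply/mkseq_uniqP => i j; rewrite !inE; apply: uI.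
have fu i : i <= n -> f (u i) = F i.
  move=> lein; rewrite /f -[u i](nth_mkseq (u 0) u (lein : i < n.+1)).
  by rewrite index_uniq // size_mkseq.
have radf : radio_labeling e f.
  move=> x y; have [i lti <-] := uS x; have [j ltj <-] := uS y => nij.
  rewrite diam_d !fu //; have [ltij|ltji|eqij] := ltngtP i j.
  - by have := gap i j; rewrite ltij -ltnS ltj => /(_ isT); lia.
  - have := gap j i; rewrite ltji -ltnS lti => /(_ isT).
    by rewrite (distC conn esym (u j)); lia.
  by rewrite eqij eqxx in nij.
have F0 : F 0 = 0 by rewrite /F big_ord0.
have spanf : Defs.span f = F n.
  apply/eqP; rewrite eqn_leq; apply/andP; split; last first.
    by have := span_ge f (u n) (u 0); rewrite !fu // F0 addn0.
  apply/bigmax_leqP=> x _; apply/bigmax_leqP=> y _.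
  have [i lti <-] := uS x; have [j ltj <-] := uS y; rewrite !fu //.
  by have := Fmono i n lti; have := Fmono j n ltj; lia.
(* [f] bounds the minimum from above, [radio_span_ge] with [FE] from below. *)
have rnE : rn e = F n.
  rewrite /rn; case: ex_minnP => m /boolp.asboolP[g [radg <-]] min_g.
  have := min_g (F n); rewrite boolp.asboolT; last by exists f.
  move=> /(_ isT) le1; have := radio_span_ge treeT _ radg.
  by rewrite order_p diam_d => /(_ n0) /=; lia.
split; first by rewrite rnE; lia.
exists f; split; [by rewrite fu | | by split; rewrite ?rnE].
move=> i ltin; rewrite !fu //; last exact: ltnW.
by have := dF i; have := dL i ltin; lia.
Qed.
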